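(* For every nonnegative integer $n$, $$pod(n)=\sum_{j=0}^{\infty}a\!\left(\frac n2-\frac{j(j+1)}{4}\right),$$ where $a(x)=0$ if $x$ is not an integer.
   Context: $pod(n)$ denotes the number of partitions of $n$ in which odd parts are distinct and even parts may be repeated, with $pod(0)=1$. $a(n)$ is the cubic partition function: the number of partitions of $n$ in which the even parts can appear in two colors, with $a(0)=1$ and $a(x)=0$ for $x<0$; its generating function is $\sum_{n\ge0}a(n)q^n=\prod_{k\ge1}\frac{1}{(1-q^k)(1-q^{2k})}$. *)

(* Defs.v *)
From mathcomp Require Import all_boot all_order all_algebra.
From mathcomp Require Import finmap boolp classical_sets cardinality fsbigop.
From mathcomp Require Import lra.

Set Implicit Arguments.
Unset Strict Implicit.
Unset Printing Implicit Defensive.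

Import Order.TTheory GRing.Theory Num.Theory.

(* A partition of n is encoded by its multiplicities: m i is the number of
   parts equal to i.+1.  Parts and multiplicities are at most n, so the bounds
   in the types below exclude nothing. *)

Definition pod_partition (n : nat) (m : {ffun 'I_n -> 'I_n.+1}) : bool :=
  (\sum_(i < n) i.+1 * m i == n) && [forall i : 'I_n, odd i.+1 ==> (m i <= 1)].

Definition pod (n : nat) : nat :=
  #|[set m : {ffun 'I_n -> 'I_n.+1} | pod_partition m]|.

(* m (i, c) is the number of parts equal to i.+1 of colour c; odd parts only
   come in the colour false. *)
Definition cubic_partition (n : nat) (m : {ffun 'I_n * bool -> 'I_n.+1})
    : bool :=
  (\sum_(p : 'I_n * bool) p.1.+1 * m p == n) &&
  [forall i : 'I_n, odd i.+1 ==> (m (i, true) == 0 :> nat)].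

Definition cubic (n : nat) : nat :=
  #|[set m : {ffun 'I_n * bool -> 'I_n.+1} | cubic_partition m]|.

Local Open Scope ring_scope.

Definition a (x : rat) : nat :=
  if x \is a Num.nat then cubic (Num.truncn x) else 0%N.

Lemma a_lt0 (x : rat) : x < 0 -> a x = 0%N.
Proof. by rewrite /a; case: ifP => // /natr_ge0; rewrite leNgt => /negPf->. Qed.

(* \sum_(j \in setT) of fsbigop defaults to 0 on infinite supports; here the
   support is always finite, so this is a genuine infinite sum. *)
Lemma finite_support_a (n : nat) :
  finite_set [set j : nat | a (n%:R / 2 - (j * j.+1)%:R / 4) != 0%N]%classic.
Proof.
apply: (sub_finite_set _ (finite_II (2 * n).+1)) => j /= anz.
rewrite ltnS leqNgt; apply: contraNN anz => ltj; apply/eqP/a_lt0.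
have : (2 * n)%:R < (j * j.+1)%:R :> rat.
  by rewrite ltr_nat (leq_trans ltj)// leq_pmulr.
rewrite !natrM; lra.
Qed.

(* Main.v *)
(* Write E, O, O+, F for the products of 1 - q^2r, 1 - q^(2r-1), 1 + q^(2r-1),
   1 - q^4r over r >= 1.  The generating functions are O+ / E for pod and
   1 / (E F) for the cubic partition function at q^2, so the claim reads
   O+ F = theta with theta = \sum_(j >= 0) q^(j(j+1)/2).  Since
   O+ O F = E, this is Gauss's identity O theta = E, which follows from a
   finite telescoping identity of Shanks. *)

Require Import Defs.
From mathcomp Require Import all_boot all_order all_algebra.
From mathcomp Require Import classical_sets fsbigop.
From mathcomp Require Import ring lra zify.
Import Order.TTheory GRing.Theory Num.Theory.
Local Open Scope ring_scope.

Set Implicit Arguments.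
Unset Strict Implicit.
Unset Printing Implicit Defensive.

(** * Truncated power series: polynomials compared modulo a power of ['X] *)

Definition congX (F : fieldType) (M : nat) (p r : {poly F}) : bool := 'X^M %| p - r.

Lemma congX_refl (F : fieldType) M (p : {poly F}) : congX M p p.
Proof. by rewrite /congX subrr dvdp0. Qed.

Lemma congX_sym (F : fieldType) M (p r : {poly F}) : congX M p r -> congX M r p.
Proof. by rewrite /congX -opprB dvdpNr. Qed.

Lemma congX_trans (F : fieldType) M (r p s : {poly F}) :
  congX M p r -> congX M r s -> congX M p s.
Proof. by move=> h k; rewrite /congX -[p](subrK r) -addrA dvdp_add. Qed.

Lemma congXM (F : fieldType) M (p p' r r' : {poly F}) :
  congX M p p' -> congX M r r' -> congX M (p * r) (p' * r').
Proof.
move=> h k; rewrite /congX.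
have -> : p * r - p' * r' = (p - p') * r + p' * (r - r') by ring.
by apply: dvdp_add; [exact: dvdp_mulr | exact: dvdp_mull].
Qed.

Lemma congX_prod (F : fieldType) M (I : finType) (f g : I -> {poly F}) :
  (forall i, congX M (f i) (g i)) -> congX M (\prod_i f i) (\prod_i g i).
Proof.
move=> h; apply: (big_ind2 (congX M)) => // [|p p' r r'].
  exact: congX_refl.
exact: congXM.
Qed.

Lemma congX_prod_widen (F : fieldType) M n N (f : nat -> {poly F}) :
  (n <= N)%N ->
  (forall i, (n <= i)%N -> congX M (f i) 1) ->
  congX M (\prod_(i < n) f i) (\prod_(i < N) f i).
Proof.
move=> /subnKC<- h; elim: (N - n)%N => [|k IH]; first by rewrite addn0 congX_refl.
rewrite addnS big_ord_recr -[X in congX _ X _]mulr1.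
by apply: congXM => //; apply/congX_sym/h/leq_addr.
Qed.

Lemma congX_leq (F : fieldType) M M' (p r : {poly F}) :
  (M' <= M)%N -> congX M p r -> congX M' p r.
Proof. by move=> h; apply: dvdp_trans; rewrite dvdp_exp2l. Qed.

Lemma congX_coef (F : fieldType) M (p r : {poly F}) i :
  congX M p r -> (i < M)%N -> p`_i = r`_i.
Proof.
move=> /dvdpP[t h] iM; apply/eqP; rewrite -subr_eq0 -coefB h.
by rewrite coefMXn iM.
Qed.

(** A polynomial with nonzero constant term is coprime to ['X^M], so Gauss's lemma removes it. *)
Lemma congX_cancel (F : fieldType) M (p r s : {poly F}) : s`_0 != 0 ->
  congX M (p * s) (r * s) -> congX M p r.
Proof.
move=> s0; rewrite /congX -mulrBl Gauss_dvdpl//.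
rewrite coprimep_expl// coprimep_sym -['X]subr0 -polyC0 coprimep_XsubC.
by rewrite /root horner_coef0.
Qed.

Lemma congX_comp (F : fieldType) M (p r : {poly F}) k :
  congX M p r -> congX (k * M) (p \Po 'X^k) (r \Po 'X^k).
Proof.
move=> /dvdpP[t h]; rewrite /congX -comp_polyB h comp_polyM comp_Xn_poly.
by rewrite exprM dvdp_mull.
Qed.

Lemma congX_1subXn (F : fieldType) M k :
  (M <= k)%N -> congX M (1 - 'X^k : {poly F}) 1.
Proof. by move=> h; rewrite /congX addrAC subrr add0r dvdpNr dvdp_exp2l. Qed.

Lemma congX_1addXn (F : fieldType) M k :
  (M <= k)%N -> congX M (1 + 'X^k : {poly F}) 1.
Proof. by move=> h; rewrite /congX addrAC subrr add0r dvdp_exp2l. Qed.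

(** * Generating functions as finite products *)

(** Expanding the product picks one exponent [k] per index [i]; such a choice is a multiplicity
    function [m], and its monomial has degree equal to the weight of [m]. *)
Lemma coef_prod_count (R : comNzSemiRingType) (I : finType) (K : nat) (w : I -> nat)
    (A : I -> pred nat) (n : nat) :
  (\prod_i \sum_(k < K | A i k) 'X^(w i * k) : {poly R})`_n =
  #|[set m : {ffun I -> 'I_K} |
      (\sum_i w i * m i == n)%N && [forall i, A i (m i)]]|%:R.
Proof.
rewrite bigA_distr_big_dep coef_sum -sum1_card natr_sum big_mkcond.
rewrite [RHS]big_mkcond; apply: eq_bigr => m _.
rewrite inE prodrXr coefXn eq_sym andbC.
have -> : (m \in family (fun i => [pred k : 'I_K | A i k])) = [forall i, A i (m i)].
  by apply/familyP/forallP => h i; exact: h.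
by case: forallP => // _; case: eqP.
Qed.

Local Notation P := {poly rat}.

Definition geom (n i : nat) : P := \sum_(k < n.+1) 'X^(i * k).

Lemma geomP n i : (0 < i)%N -> congX n.+1 (geom n i * (1 - 'X^i)) 1.
Proof.
move=> i0; have -> : geom n i * (1 - 'X^i) = 1 - 'X^(i * n.+1).
  rewrite exprM -[RHS]opprB subrX1 mulrC -mulNr opprB; congr (_ * _).
  by apply: eq_bigr => k _; rewrite exprM.
by apply: congX_1subXn; rewrite leq_pmull.
Qed.

(* Although pod_gf n and cubic_gf n have finitely many, truncated factors, they
   agree with the infinite products up to degree n. *)
Definition pod_gf (n : nat) : P :=
  \prod_(i < n) (if odd i.+1 then 1 + 'X^(i.+1) else geom n i.+1).

Lemma pod_coef n : (pod n)%:R = (pod_gf n)`_n.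
Proof.
rewrite /pod -[in LHS](@coef_prod_count rat _ _ (fun i : 'I_n => i.+1)
  (fun i k => odd i.+1 ==> (k <= 1)%N)); congr (_ : P)`_ _.
apply: eq_bigr => -[i ltin] _ /=; case: odd => //=.
(* Since [i < n] forces [n > 0], both terms [k = 0] and [k = 1] lie in the range and can be split
   off. *)
case: n ltin => // n _; rewrite big_mkcond /= !big_ord_recl /=.
by rewrite big1 ?addr0 ?muln0 ?muln1.
Qed.

Definition cubic_gf (n : nat) : P :=
  \prod_(i < n) (geom n i.+1 * (if odd i.+1 then 1 else geom n i.+1)).

Lemma cubic_coef_diag n : (cubic n)%:R = (cubic_gf n)`_n.
Proof.
(* The colour restriction is restated pointwise on pairs, as the product expansion requires. *)
have -> : cubic n = #|[set m : {ffun 'I_n * bool -> 'I_n.+1} |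
      (\sum_(p : 'I_n * bool) p.1.+1 * m p == n)%N &&
      [forall p : 'I_n * bool, (odd p.1.+1 && p.2) ==> (m p == 0 :> nat)]]|.
  apply: eq_card => m; rewrite !inE; congr (_ && _).
  apply/forallP/forallP => h => [[i []]|i]; rewrite /= ?andbF// ?andbT; first exact: h.
  by have := h (i, true); rewrite andbT.
rewrite -[in LHS](@coef_prod_count rat _ _ (fun p : 'I_n * bool => p.1.+1)
  (fun p k => (odd p.1.+1 && p.2) ==> (k == 0)%N)); congr (_ : P)`_ _.
rewrite -(pair_bigA _ (fun (i : 'I_n) (b : bool) =>
  \sum_(k < n.+1 | (odd i.+1 && b) ==> (k == 0 :> nat)) 'X^(i.+1 * k))) /=.
apply: eq_bigr => i _; rewrite big_bool mulrC andbF andbT /=; congr (_ * _).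
case: odd => //=.
by rewrite big_mkcond big_ord_recl /= big1 ?addr0 ?muln0.
Qed.

(** Truncated reciprocal of the cubic generating function; inverses are avoided by multiplying with
    it. *)
Definition cubic_den (N : nat) : P :=
  \prod_(i < N) ((1 - 'X^(i.+1)) * (if odd i.+1 then 1 else 1 - 'X^(i.+1))).

Lemma cubic_gf_den n : congX n.+1 (cubic_gf n * cubic_den n) 1.
Proof.
rewrite -big_split /=; apply: (congX_trans (r := \prod_(i < n) 1)); last first.
  by rewrite big1 ?congX_refl.
apply: congX_prod => i.
rewrite mulrACA -[X in congX _ _ X]mulr1; apply: congXM; first exact: geomP.
by case: ifP => _; [rewrite mulr1 congX_refl | exact: geomP].
Qed.

Lemma cubic_den_widen n N : (n <= N)%N ->
  congX n.+1 (cubic_den n) (cubic_den N).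
Proof.
move=> nN; apply: (congX_prod_widen
  (f := fun i => (1 - 'X^(i.+1)) * (if odd i.+1 then 1 else 1 - 'X^(i.+1)))) => // i ni.
rewrite -[X in congX _ _ X]mulr1; apply: congXM; first exact: congX_1subXn.
by case: ifP => _; [exact: congX_refl | exact: congX_1subXn].
Qed.

(** Lets one polynomial supply all coefficients up to [n]. Modulo ['X^(m.+1)], [cubic_gf m] and
    [cubic_gf n] invert the same denominator, and inverses are unique. *)
Lemma cubic_coef m n : (m <= n)%N -> (cubic m)%:R = (cubic_gf n)`_m.
Proof.
move=> mn; rewrite cubic_coef_diag; apply: congX_coef (ltnSn m).
apply: (congX_trans (r := cubic_gf m * (cubic_gf n * cubic_den n))).
  rewrite -[X in congX _ X]mulr1 congXM ?congX_refl//; apply: congX_sym.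
  exact: congX_leq (cubic_gf_den n).
rewrite mulrCA -[X in congX _ _ X]mulr1 congXM ?congX_refl//.
apply: congX_trans (cubic_gf_den m); rewrite congXM ?congX_refl//.
exact/congX_sym/cubic_den_widen.
Qed.

(** * Product identities and Gauss's identity *)

Definition evens (N : nat) : P := \prod_(r < N) (1 - 'X^(2 * r.+1)).
Definition odds (N : nat) : P := \prod_(r < N) (1 - 'X^((2 * r).+1)).
Definition plus_odds (N : nat) : P := \prod_(r < N) (1 + 'X^((2 * r).+1)).
Definition fours (N : nat) : P := \prod_(r < N) (1 - 'X^(4 * r.+1)).
Definition theta (N : nat) : P := \sum_(k < N) 'X^('C(k.+1, 2)).

(** Index [i] stands for the part [i.+1], so odd parts sit at even indices. *)
Lemma prod_parity (f g : nat -> P) N :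
  \prod_(i < 2 * N) (if odd i.+1 then f i else g i) =
  (\prod_(i < N) f (2 * i)%N) * \prod_(i < N) g (2 * i).+1.
Proof.
elim: N => [|N IH]; first by rewrite muln0 !big_ord0 mulr1.
rewrite mulnS addnC addn2 !big_ord_recr /= IH oddM /=; ring.
Qed.

Lemma pod_gf_evens n N : (n <= 2 * N)%N ->
  congX n.+1 (pod_gf n * evens N) (plus_odds N).
Proof.
move=> nN.
(* Padding with factors 1 lets both products run over all parts, to be compared factor by factor. *)
pose h i : P := if odd i.+1 then 1 else 1 - 'X^(i.+1).
pose g i : P := if odd i.+1 then 1 + 'X^(i.+1) else 1.
have hE : evens N = \prod_(i < 2 * N) h i.
  rewrite (prod_parity (fun=> 1) (fun i => 1 - 'X^(i.+1))) big1// mul1r.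
  by apply: eq_bigr => i _; rewrite mulnS.
have gE : plus_odds N = \prod_(i < 2 * N) g i.
  by rewrite (prod_parity (fun i => 1 + 'X^(i.+1)) (fun=> 1)) mulrC big1// mul1r.
rewrite hE gE.
apply: (congX_trans (r := pod_gf n * \prod_(i < n) h i)).
  rewrite congXM ?congX_refl//; apply/congX_sym/congX_prod_widen => // i ni.
  by rewrite /h; case: ifP => _; [exact: congX_refl | exact: congX_1subXn].
apply: (congX_trans (r := \prod_(i < n) g i)).
  rewrite -big_split; apply: congX_prod => i /=.
  rewrite /h /g /=; case: (odd i) => /=; first exact: geomP.
  by rewrite mulr1 congX_refl.
apply: congX_prod_widen => // i ni.
by rewrite /g; case: ifP => _; [exact: congX_1addXn | exact: congX_refl].
Qed.

Lemma cubic_den_comp N : cubic_den (2 * N) \Po 'X^2 = evens (2 * N) * fours N.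
Proof.
have sX k : (1 - 'X^k : P) \Po 'X^2 = 1 - 'X^(2 * k).
  by rewrite comp_polyB comp_polyC comp_Xn_poly -exprM.
rewrite /cubic_den big_split rmorphM !rmorph_prod /=; congr (_ * _).
  by apply: eq_bigr => i _; exact: sX.
rewrite (eq_bigr (fun i : 'I_(2 * N) => if odd i.+1 then 1 else 1 - 'X^(2 * i.+1) : P)).
  rewrite (prod_parity (fun=> 1) (fun i => 1 - 'X^(2 * i.+1))) big1// mul1r.
  by apply: eq_bigr => i _; congr (1 - 'X^_); lia.
by move=> i _ /=; case: (odd i) => /=; [exact: sX | exact: comp_polyC].
Qed.

(** Each [(1 + y) * (1 - y) = 1 - y ^+ 2] with [y] an odd power of ['X] yields an exponent congruent
    to 2 modulo 4; [fours] supplies the multiples of 4. *)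
Lemma plus_odds_odds N : plus_odds N * odds N * fours N = evens (2 * N).
Proof.
elim: N => [|N IH]; first
  by rewrite /evens muln0 /plus_odds /odds /fours !big_ord0 !mulr1.
rewrite /evens mulnS addnC addn2 !big_ord_recr /= -/(evens _) -IH.
rewrite /plus_odds /odds /fours !big_ord_recr /=.
have -> : 'X^(2 * (2 * N).+1) = 'X^((2 * N).+1) * 'X^((2 * N).+1) :> P.
  by rewrite -exprD; congr 'X^_; lia.
have -> : (2 * (2 * N).+2 = 4 * N.+1)%N by lia.
ring.
Qed.

(* Shanks' finite form of Gauss's identity
   theta(q) = \prod (1 - q^2r) / (1 - q^(2r-1)), with denominators cleared:
   only the term s = 0 survives modulo q^(2N+1). *)
Definition shanks_term (N s : nat) : P :=
  odds s * \prod_(s.+1 <= r < N.+1) (1 - 'X^(2 * r)).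

Lemma shanks_identity N :
  odds N * theta (2 * N) =
  \sum_(s < N) shanks_term N s * 'X^(s * (2 * N).+1).
Proof.
elim: N => [|N IH]; first by rewrite big_ord0 /theta muln0 big_ord0 mulr0.
pose x : P := 'X^((2 * N).+1).
have oddsS s : odds s.+1 = odds s * (1 - 'X^((2 * s).+1)).
  by rewrite /odds big_ord_recr.
(* [U] is a discrete primitive in [s] of [d], the change of the summand from [N] to [N.+1] once the
   old one is scaled by [1 - x]. *)
pose U s : P := odds s * (\prod_(s <= r < N.+1) (1 - 'X^(2 * r))) * x ^+ s.
pose d s : P := shanks_term N.+1 s * 'X^(s * (2 * N.+1).+1)
  - (1 - x) * (shanks_term N s * 'X^(s * (2 * N).+1)).
have tele : \sum_(s < N.+1) d s = U N.+1.
  (* The product in [U 0] contains the factor [r = 0], which is [1 - 'X^0 = 0]. *)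
  have U0 : U 0 = 0 by rewrite /U big_nat_recl//= muln0 subrr mul0r mulr0 mul0r.
  rewrite -[RHS]subr0 -[X in _ - X]U0 -(big_mkord xpredT d).
  apply: telescope_sumr_eq => // s /andP[_ ltsN].
  rewrite /d /U /shanks_term oddsS (big_ltn ltsN) (@big_nat_recr _ _ _ N.+1)//=.
  have -> : 'X^(s * (2 * N.+1).+1) = 'X^(2 * s) * x ^+ s :> P.
    by rewrite /x -exprM -exprD; congr 'X^_; lia.
  have -> : 'X^(s * (2 * N).+1) = x ^+ s by rewrite mulnC exprM.
  have -> : 'X^(2 * N.+1) = x * 'X :> P by rewrite /x -exprSr mulnS.
  rewrite !exprS; ring.
have -> : theta (2 * N.+1)
    = theta (2 * N) + 'X^('C((2 * N).+1, 2)) + 'X^('C((2 * N).+2, 2)).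
  by rewrite /theta mulnS !big_ord_recr.
rewrite oddsS.
move: tele; rewrite /d sumrB -mulr_sumr => /(canRL (subrK _))->.
(* The extra summand [s = N] and the boundary value [U N.+1] provide the two new terms of [theta],
   with exponents [N * (2 * N).+1] and [N.+1 * (2 * N).+1]. *)
rewrite big_ord_recr /= -IH /U /shanks_term !big_geq// oddsS -/x.
have -> : 'X^('C((2 * N).+1, 2)) = 'X^(N * (2 * N).+1) :> P.
  by rewrite bin2 /= mulnC -mulnA mul2n doubleK.
have -> : 'X^('C((2 * N).+2, 2)) = x ^+ N.+1 :> P.
  rewrite bin2 -pred_Sn /x -exprM; congr 'X^_.
  have -> : ((2 * N).+2 = 2 * N.+1)%N by lia.
  by rewrite -mulnA mul2n doubleK mulnC.
ring.
Qed.

Lemma odds_theta N : (0 < N)%N ->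
  congX (2 * N).+1 (odds N * theta (2 * N)) (evens N).
Proof.
case: N => // N _; rewrite shanks_identity big_ord_recl /= mul0n mulr1.
have -> : shanks_term N.+1 0 = evens N.+1.
  by rewrite /shanks_term /odds big_ord0 mul1r big_add1 big_mkord.
rewrite /congX addrAC subrr add0r.
apply: (big_ind (fun p : P => 'X^((2 * N.+1).+1) %| p)) => [|p r|i _].
- exact: dvdp0.
- exact: dvdp_add.
by apply/dvdp_mull/dvdp_exp2l; rewrite leq_pmull.
Qed.

Lemma evens_widen N : congX (2 * N).+1 (evens N) (evens (2 * N)).
Proof.
apply: (congX_prod_widen (f := fun i => 1 - 'X^(2 * i.+1))) => [|i ni]; first by lia.
by apply: congX_1subXn; lia.
Qed.

Lemma coef0_prod_1subXn N (e : nat -> nat) : (forall i, (0 < e i)%N) ->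
  (\prod_(r < N) (1 - 'X^(e r)) : P)`_0 = 1.
Proof.
move=> e0; rewrite -horner_coef0 horner_prod big1// => i _.
by rewrite !hornerE expr0n gtn_eqF// subr0.
Qed.

(** Multiplied by [odds N], which has constant term 1, both sides become the product of the
    [1 - q^2r]. *)
Lemma plus_odds_fours N : (0 < N)%N ->
  congX (2 * N).+1 (plus_odds N * fours N) (theta (2 * N)).
Proof.
move=> N0; apply: (@congX_cancel _ _ _ _ (odds N)).
  by rewrite (@coef0_prod_1subXn N (fun r => (2 * r).+1)) ?oner_eq0.
rewrite mulrAC plus_odds_odds mulrC.
apply: (congX_trans (r := evens N)); apply/congX_sym; first exact: evens_widen.
exact: odds_theta.
Qed.

Lemma pod_gf_cubic n :
  congX n.+1 (pod_gf n) ((cubic_gf n \Po 'X^2) * theta (2 * n.+1)).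
Proof.
set N := n.+1; set C := _ \Po _.
have CE : congX n.+1 (C * (evens N * fours N)) 1.
  have h : congX n.+1 (cubic_gf n * cubic_den (2 * N)) 1.
    apply: congX_trans (cubic_gf_den n); rewrite congXM ?congX_refl//.
    by apply/congX_sym/cubic_den_widen; lia.
  (* Substituting ['X^2] doubles the precision, so more than enough remains. *)
  have := congX_comp 2 h; rewrite comp_polyM comp_polyC cubic_den_comp => h2.
  apply: congX_trans (congX_leq _ h2); last by lia.
  rewrite !congXM ?congX_refl//; apply: congX_leq (evens_widen N); lia.
apply: (congX_trans (r := pod_gf n * (C * (evens N * fours N)))).
  by rewrite -[X in congX _ X]mulr1 congXM ?congX_refl// congX_sym.
have -> : pod_gf n * (C * (evens N * fours N))
    = C * (pod_gf n * evens N * fours N) by ring.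
rewrite congXM ?congX_refl//.
apply: (congX_trans (r := plus_odds N * fours N)).
  by rewrite congXM ?congX_refl// pod_gf_evens//; lia.
by apply: congX_leq (plus_odds_fours _); rewrite /N; lia.
Qed.

(** * Extraction of coefficients *)

Lemma coef_comp_X2 (p : P) i :
  (p \Po 'X^2)`_i = if odd i then 0 else p`_(i./2).
Proof. by rewrite coef_comp_poly_Xn// dvdn2 divn2; case: odd. Qed.

Lemma a_half (n t : nat) :
  a ((n%:R - t%:R) / 2) =
  if (t <= n)%N && ~~ odd (n - t) then cubic (n - t)./2 else 0%N.
Proof.
have [tn|nt] := leqP t n; last first.
  by move: nt; rewrite -(ltr_nat rat) => nt; rewrite a_lt0//; lra.
rewrite -natrB//=; set d := (n - t)%N; rewrite -[in LHS](odd_double_half d) /a.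
case: odd => /=; last by rewrite -muln2 natrM mulfK// natr_nat natrK.
(* For odd [d], an integral value [k] of [d / 2] would give [d = 2 * k]. *)
rewrite ifF//; apply/negP => /natrP[k /(congr1 ( *%R^~ 2))].
rewrite divfK// -natrM => /eqP; rewrite eqr_nat => /eqP; lia.
Qed.

Theorem theorem4p15 (n : nat) :
  pod n = \sum_(j \in [set: nat]%classic)
            a ((n%:R / 2 : rat) - (j * j.+1)%:R / 4).
Proof.
have aE j : a ((n%:R / 2 : rat) - (j * j.+1)%:R / 4) =
    if ('C(j.+1, 2) <= n)%N && ~~ odd (n - 'C(j.+1, 2))
    then cubic (n - 'C(j.+1, 2))./2 else 0%N.
  rewrite -a_half; congr a.
  have -> : (j * j.+1 = 2 * 'C(j.+1, 2))%N.
    by rewrite bin2 mul2n even_halfK ?oddM /= ?andNb// mulnC.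
  rewrite natrM; lra.
(* This bound is the length of [theta] in [pod_gf_cubic]; beyond it the triangular number exceeds
   [n] and [a] vanishes. *)
transitivity (\sum_(j < 2 * n.+1) a ((n%:R / 2 : rat) - (j * j.+1)%:R / 4)); last first.
  rewrite (fsbig_ord _ _ (fun j => a ((n%:R / 2 : rat) - (j * j.+1)%:R / 4))).
  apply: fsbig_widen => // j [_ /= /negP]; rewrite -leqNgt => nj.
  rewrite aE leqNgt bin2 /=.
  suff -> : (n < (j.+1 * j)./2)%N by [].
  nia.
apply/eqP; rewrite -(eqr_nat rat) pod_coef (congX_coef (pod_gf_cubic n))//.
rewrite natr_sum /theta mulr_sumr coef_sum; apply/eqP/eq_bigr => j _.
(* Multiplication by ['X^t], [t] triangular, shifts the coefficient to [n - t]; in a polynomial in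
   ['X^2] it is zero for odd [n - t], matching the non-integral case of [a]. *)
rewrite aE coefMXn coef_comp_X2 ltnNge.
case: leqP => //= _; case: ifP => //= _.
by rewrite (@cubic_coef _ n)//; lia.
Qed.
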